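(* Let $\phi=\frac{1+\sqrt5}{2}$. In the Euclidean plane perform the following construction. (1) Construct a segment $AB$ with $AB=1$, a point $C$ on the extension of $AB$ beyond $B$ such that $\frac{BC}{BA}=\phi$, and extend $BC$ beyond $C$ to the point $D$ such that $CD=BC$. (2) Draw a semicircle with center the midpoint $O$ of $AD$ and radius $OA$ (so it passes through $D$ and has diameter $AD$). (3) Through $B$ construct the segment $BE$ perpendicular to $AB$, meeting the semicircle at the point $E$, and join $E$ to $A$. Then $\triangle ABE$ is the maximum generalized golden right triangle $T_2$, that is, a right triangle with sides $AB=1$, $BE=\sqrt{2\phi}$, $AE=\phi\sqrt{\phi}$.
   Context: $XY$ denotes the length of the segment with endpoints $X$ and $Y$. The maximum generalized golden right triangle $T_2$ is the right triangle with side lengths $(1,\sqrt{2\phi},\phi\sqrt{\phi})$. *)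

(* Defs.v *)
From Stdlib Require Import Reals.
Open Scope R_scope.

Definition phi : R := (1 + sqrt 5) / 2.

Definition point : Type := (R * R)%type.

Definition vec (X Y : point) : R * R := (fst Y - fst X, snd Y - snd X).

Definition dot (u v : R * R) : R := fst u * fst v + snd u * snd v.

Definition cross (u v : R * R) : R := fst u * snd v - snd u * fst v.

Definition len (X Y : point) : R := dist_euc (fst X) (snd X) (fst Y) (snd Y).

(* [Y] lies strictly between [X] and [Z], i.e. [Z] lies on the extension of
   the segment [XY] beyond [Y]. *)
Definition between (X Y Z : point) : Prop :=
  exists t : R, 0 < t < 1 /\
    Y = (fst X + t * (fst Z - fst X), snd X + t * (snd Z - snd X)).

Definition collinear (X Y Z : point) : Prop := cross (vec X Y) (vec X Z) = 0.

Definition perpendicular (W X Y Z : point) : Prop :=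
  dot (vec W X) (vec Y Z) = 0.

Definition midpoint (X Y : point) : point :=
  ((fst X + fst Y) / 2, (snd X + snd Y) / 2).

(* The semicircle with center [O] and radius [OA] bounded by the line [OA] and
   lying on the same side of it as [Q], endpoints included; it is meaningful
   only when [Q] is not on the line [OA]. *)
Definition semicircle (O A Q X : point) : Prop :=
  len O X = len O A /\
  0 <= cross (vec O A) (vec O Q) * cross (vec O A) (vec O X).

Definition right_triangle_at (X Y Z : point) : Prop :=
  ~ collinear X Y Z /\ perpendicular X Y Y Z.

(* The right angle is at the middle vertex. *)
Definition max_gen_golden_right_triangle (X Y Z : point) : Prop :=
  right_triangle_at X Y Z /\
  len X Y = 1 /\ len Y Z = sqrt (2 * phi) /\ len X Z = phi * sqrt phi.

(* Main.v *)
(** Put [u = B - A], a unit vector, and [n] the rotation of [u] by a right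
    angle. Then [D - B = 2 phi u], and the points of the perpendicular through
    [B] are [E = B + s n]. Such an [E] is on the circle with diameter [AD] iff
    [s^2 = 2 phi] (the altitude theorem [BE^2 = AB * BD]), and the side of [AD]
    fixes the sign of [s]. Finally [AE^2 = 1 + 2 phi = phi^3]. *)
Require Import Defs.
From Stdlib Require Import Reals Lra Psatz.
Open Scope R_scope.

Lemma phi_pos : 0 < phi.
Proof. unfold phi. pose proof (sqrt_pos 5). lra. Qed.

Lemma phi_sqr : phi * phi = phi + 1.
Proof.
  unfold phi. pose proof (sqrt_sqrt 5 ltac:(lra)) as H5.
  replace ((1 + sqrt 5) / 2 * ((1 + sqrt 5) / 2))
    with ((1 + 2 * sqrt 5 + sqrt 5 * sqrt 5) / 4) by field.
  rewrite H5. field.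
Qed.

Lemma len_nonneg X Y : 0 <= len X Y.
Proof. apply sqrt_pos. Qed.

Lemma len_sqr X Y : len X Y * len X Y = dot (vec X Y) (vec X Y).
Proof.
  unfold len, dist_euc.
  rewrite sqrt_sqrt by (apply Rplus_le_le_0_compat; apply Rle_0_sqr).
  unfold dot, vec, Rsqr; simpl. ring.
Qed.

Lemma sqr_eq_nonneg x y : 0 <= x -> 0 <= y -> x * x = y * y -> x = y.
Proof. intros Hx Hy H. apply Rsqr_inj; assumption. Qed.

Lemma len_sym X Y : len X Y = len Y X.
Proof. apply distance_symm. Qed.

Definition extend (X Y : point) (k : R) : point :=
  (fst Y + k * (fst Y - fst X), snd Y + k * (snd Y - snd X)).

Lemma len_extend X Y k : 0 <= k -> len Y (extend X Y k) = k * len X Y.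
Proof.
  intros Hk. pose proof (len_nonneg X Y) as Hl.
  apply sqr_eq_nonneg; [apply len_nonneg | nra |].
  rewrite len_sqr.
  replace (k * len X Y * (k * len X Y))
    with (k * k * (len X Y * len X Y)) by ring.
  rewrite len_sqr. unfold dot, vec, extend; simpl. ring.
Qed.

Lemma between_extend X Y Z :
  between X Y Z -> exists k, 0 < k /\ Z = extend X Y k.
Proof.
  (* Betweenness gives [Y - X = t (Z - X)] and [Z - Y = (1 - t) (Z - X)], and [k] is their ratio. *)
  intros (t & Ht & ->). exists ((1 - t) / t). split.
  - apply Rdiv_lt_0_compat; lra.
  - destruct X, Z. unfold extend; simpl. f_equal; field; lra.
Qed.

Lemma between_extend_ratio X Y Z k :
  0 < len X Y -> between X Y Z -> len Y Z = k * len X Y -> Z = extend X Y k.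
Proof.
  intros Hl HZ Hk. destruct (between_extend _ _ _ HZ) as (m & Hm & ->).
  rewrite len_extend in Hk by lra. f_equal.
  apply (Rmult_eq_reg_r (len X Y)); lra.
Qed.

(** The offset from [Y] is [s] times the counterclockwise quarter turn of [vec X Y]; the sign of [s]
    tells the side of the line. *)
Definition erect (X Y : point) (s : R) : point :=
  (fst Y - s * (snd Y - snd X), snd Y + s * (fst Y - fst X)).

Lemma perpendicular_erect X Y s : perpendicular X Y Y (erect X Y s).
Proof. unfold perpendicular, dot, vec, erect; simpl. ring. Qed.

Lemma perpendicular_erect_ex X Y Z :
  len X Y = 1 -> perpendicular X Y Y Z -> exists s, Z = erect X Y s.
Proof.
  intros H1 Hp. pose proof (len_sqr X Y) as Hu. rewrite H1 in Hu.
  (* The unit vector [vec X Y] and its quarter turn form an orthonormal frame; this is the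
     coordinate of [vec Y Z] along the latter. *)
  exists (cross (vec X Y) (vec Y Z)).
  destruct X as [x1 x2], Y as [y1 y2], Z as [z1 z2].
  unfold perpendicular, dot, cross, vec, erect in *; simpl in *.
  set (p := y1 - x1) in *. set (q := y2 - x2) in *.
  f_equal.
  (* Inserting [p * p + q * q = 1] lets the dot product, which vanishes, be split off. *)
  - replace z1 with (y1 + (p * p + q * q) * (z1 - y1)) at 1
      by (rewrite <- Hu; ring).
    transitivity (y1 + p * (p * (z1 - y1) + q * (z2 - y2))
                  - (p * (z2 - y2) - q * (z1 - y1)) * q); [ring|].
    rewrite Hp. ring.
  - replace z2 with (y2 + (p * p + q * q) * (z2 - y2)) at 1
      by (rewrite <- Hu; ring).
    transitivity (y2 + q * (p * (z1 - y1) + q * (z2 - y2))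
                  + (p * (z2 - y2) - q * (z1 - y1)) * p); [ring|].
    rewrite Hp. ring.
Qed.

Lemma semicircle_erect A B Q k s :
  len A B = 1 -> 0 < k ->
  let O := midpoint A (extend A B k) in
  semicircle O A Q (erect A B s) <->
  s * s = k /\ 0 <= cross (vec A (extend A B k)) (vec A Q) * s.
Proof.
  (* With [D = extend A B k], the two factors of the side condition are
     [- cross (vec A D) (vec A Q) / 2] and [- (1 + k) / 2 * s], so its sign is that of the simpler
     product. *)
  intros H1 Hk O. pose proof (len_sqr A B) as Hu. rewrite H1 in Hu.
  assert (Hside : cross (vec O A) (vec O Q) * cross (vec O A) (vec O (erect A B s))
    = (1 + k) / 4 * (cross (vec A (extend A B k)) (vec A Q) * s)).
  { transitivity ((1 + k) / 4 * dot (vec A B) (vec A B)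
      * (cross (vec A (extend A B k)) (vec A Q) * s)).
    - unfold O, cross, dot, vec, midpoint, extend, erect; simpl. field.
    - rewrite <- Hu. ring. }
  (* This is the power of the erected point [E] with respect to the circle, the dot product of
     [vec E A] and [vec E D]. *)
  assert (Hcircle : len O (erect A B s) * len O (erect A B s) - len O A * len O A
    = s * s - k).
  { rewrite !len_sqr.
    transitivity ((s * s - k) * dot (vec A B) (vec A B)).
    - unfold O, dot, vec, midpoint, extend, erect; simpl. field.
    - rewrite <- Hu. ring. }
  unfold semicircle. rewrite Hside. split; intros [Hc Hs]; split.
  - rewrite Hc in Hcircle. lra.
  - nra.
  - apply sqr_eq_nonneg; [apply len_nonneg .. | lra].
  - nra.
Qed.

(** Source of the uniqueness of [E]: of the two roots of [k], the sign of [c] rejects one. *)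
Lemma sqr_root_sign_unique k c :
  0 < k -> c <> 0 -> exists! s, s * s = k /\ 0 <= c * s.
Proof.
  intros Hk Hc. pose proof (sqrt_lt_R0 k Hk) as Hr.
  pose proof (sqrt_sqrt k (Rlt_le _ _ Hk)) as Hrr.
  assert (Hroots : forall s, s * s = k -> s = sqrt k \/ s = - sqrt k).
  { intros s Hs. assert (H : (s - sqrt k) * (s + sqrt k) = 0) by lra.
    apply Rmult_integral in H. lra. }
  destruct (Rdichotomy _ _ Hc) as [Hc'|Hc'].
  - exists (- sqrt k). split; [split; nra|].
    intros s [Hs Hcs]. destruct (Hroots s Hs); subst; nra.
  - exists (sqrt k). split; [split; nra|].
    intros s [Hs Hcs]. destruct (Hroots s Hs); subst; nra.
Qed.

Lemma erect_golden A B s :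
  len A B = 1 -> s * s = 2 * phi ->
  max_gen_golden_right_triangle A B (erect A B s).
Proof.
  intros H1 Hs. pose proof phi_pos as Hphi. pose proof phi_sqr as Hphi2.
  pose proof (len_sqr A B) as Hu. rewrite H1 in Hu.
  split; [split|split; [|split]].
  (* Collinearity would force [s = 0], against [s * s = 2 * phi]. *)
  - unfold collinear. intros H.
    assert (Hc : cross (vec A B) (vec A (erect A B s))
      = s * dot (vec A B) (vec A B))
      by (unfold cross, dot, vec, erect; simpl; ring).
    rewrite H, <- Hu in Hc. nra.
  - apply perpendicular_erect.
  - exact H1.
  - apply sqr_eq_nonneg; [apply len_nonneg | apply sqrt_pos |].
    rewrite sqrt_sqrt by lra. rewrite len_sqr.
    transitivity (s * s * dot (vec A B) (vec A B));
      [unfold dot, vec, erect; simpl; ring | rewrite <- Hu, Hs; ring].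
  - pose proof (sqrt_pos phi) as Hr.
    apply sqr_eq_nonneg; [apply len_nonneg | nra |].
    rewrite len_sqr.
    transitivity ((1 + s * s) * dot (vec A B) (vec A B));
      [unfold dot, vec, erect; simpl; ring | rewrite <- Hu, Hs].
    (* Using [phi * phi = phi + 1] twice, [phi ^ 3 = phi * phi + phi = 1 + 2 * phi]. *)
    transitivity (phi * phi * (sqrt phi * sqrt phi)); [|ring].
    rewrite sqrt_sqrt by lra. nra.
Qed.

Theorem mainTheorem4 (A B C D O Q : point)
  (hAB : len A B = 1)
  (hC : between A B C) (hBC : len B C / len B A = phi)
  (hD : between B C D) (hCD : len C D = len B C)
  (hO : O = midpoint A D)
  (hQ : ~ collinear A D Q) :
  (exists! E : point, semicircle O A Q E /\ perpendicular A B B E) /\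
  (forall E : point, semicircle O A Q E -> perpendicular A B B E ->
     max_gen_golden_right_triangle A B E).
Proof.
  pose proof phi_pos as Hphi.
  rewrite (len_sym B A), hAB, Rdiv_1_r in hBC.
  apply (between_extend_ratio _ _ _ phi) in hC; [| rewrite hAB; lra ..].
  apply (between_extend_ratio _ _ _ 1) in hD; [| lra ..].
  assert (HD : D = extend A B (2 * phi)).
  { rewrite hD, hC. unfold extend; simpl. f_equal; ring. }
  clear hC hD hBC hCD. subst D O.
  assert (Hk : 0 < 2 * phi) by lra.
  split.
  (* Unfolded, [hQ] says that [cross (vec A D) (vec A Q)] is nonzero; this cross product is the [c]
     that selects the root. *)
  - destruct (sqr_root_sign_unique (2 * phi) _ Hk hQ) as (s & Hs & Huniq).
    exists (erect A B s). split.
    + split; [|apply perpendicular_erect].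
      apply semicircle_erect; assumption.
    + intros E [HE Hp].
      destruct (perpendicular_erect_ex _ _ _ hAB Hp) as (s' & ->).
      apply semicircle_erect in HE; [|assumption ..].
      f_equal. apply Huniq, HE.
  - intros E HE Hp.
    destruct (perpendicular_erect_ex _ _ _ hAB Hp) as (s & ->).
    apply semicircle_erect in HE; [|assumption ..].
    apply erect_golden; tauto.
Qed.
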